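(* Let $0<p<q\le 1$, $0\le\eta<1$, $0\le\tau\le1$, $\kappa,\xi\in\mathbb{N}_0$. Let $\varphi_1(z)=z$ and, for $\nu\ge2$, $$\varphi_\nu(z)=z-\frac{1-\eta}{[\nu]_{p,q}^{\kappa}(\nu-\eta)\big\{1+([\nu]_{p,q}-1)\tau\big\}[1+(\nu-1)\tau]^{\xi}}\,z^\nu .$$ Then a function $\varphi$ is in the class $\mathcal{P}_{p,q}^{\xi,\kappa}(\tau,\eta)$ if and only if it can be expressed in the form $$\varphi(z)=\sum_{\nu=1}^{\infty}\mu_\nu\varphi_\nu(z),\qquad\text{where }\mu_\nu\ge0\ (\nu\ge1)\text{ and }\sum_{\nu=1}^{\infty}\mu_\nu=1 .$$
   Context: $\Omega=\{z\in\mathbb{C}:|z|<1\}$; $\mathbb{N}_0=\mathbb{N}\cup\{0\}$. $\mathcal{A}$ is the class of analytic functions $\varphi$ on $\Omega$ with $\varphi(0)=0$, $\varphi'(0)=1$, so $\varphi(z)=z+\sum_{\nu\ge2}c_\nu z^\nu$. For $0<p<q\le1$, $[\nu]_{p,q}=\frac{p^\nu-q^\nu}{p-q}=\sum_{j=0}^{\nu-1}p^{\nu-1-j}q^{j}$. For $\varphi\in\mathcal{A}$, $\tau\ge0$, $\kappa,\xi\in\mathbb{N}_0$ define the operator $$\Upsilon_{\tau,p,q}^{\xi,\kappa}\varphi(z)=z+\sum_{\nu=2}^{\infty}[\nu]_{p,q}^{\kappa}[1+(\nu-1)\tau]^{\xi}c_\nu z^\nu .$$ For $0\le\eta<1$,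 $\tau\ge0$, $\mathcal{Q}_{p,q}^{\xi,\kappa}(\tau,\eta)$ is the class of $\varphi\in\mathcal{A}$ such that for all $z\in\Omega$ $$\operatorname{Re}\left\{\frac{(1-\tau)z\big(\Upsilon_{\tau,p,q}^{\xi,\kappa}\varphi(z)\big)'+\tau z\big(\Upsilon_{\tau,p,q}^{\xi,\kappa+1}\varphi(z)\big)'}{(1-\tau)\Upsilon_{\tau,p,q}^{\xi,\kappa}\varphi(z)+\tau\Upsilon_{\tau,p,q}^{\xi,\kappa+1}\varphi(z)}\right\}>\eta .$$ $\mathcal{T}$ is the subclass of $\mathcal{A}$ of functions of the form $\varphi(z)=z-\sum_{\nu=2}^{\infty}c_\nu z^\nu$ with all $c_\nu\ge0$, and $\mathcal{P}_{p,q}^{\xi,\kappa}(\tau,\eta)=\mathcal{Q}_{p,q}^{\xi,\kappa}(\tau,\eta)\cap\mathcal{T}$. *)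

(* Defs.v *)
From Stdlib Require Import Reals ClassicalEpsilon.
From Coquelicot Require Import Coquelicot.

Open Scope R_scope.

Definition Omega (z : C) : Prop := Cmod z < 1.

(* Functions on the disc are represented by total functions [C -> C]; every
   notion below depends only on the values taken on [Omega]. *)
Definition class_A (phi : C -> C) : Prop :=
  (forall z : C, Omega z ->
     ex_derive (K := C_AbsRing) (V := C_NormedModule) phi z) /\
  phi (RtoC 0) = RtoC 0 /\
  C_derive phi (RtoC 0) = RtoC 1.

Definition Cseries_sum (a : nat -> C) : C :=
  (Series (fun k => Re (a k)), Series (fun k => Im (a k))).

(* phi z = z + sum_(nu >= 2) c nu z^nu on Omega; the entries c 0 and c 1
   play no role. *)
Definition is_expansion (phi : C -> C) (c : nat -> C) : Prop :=
  forall z : C, Omega z ->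
    is_series (K := C_AbsRing) (V := C_NormedModule)
      (fun k : nat => (c (k + 2)%nat * z ^ (k + 2))%C) (phi z - z)%C.

(* The entries of index >= 2 are unique, and by Taylor's theorem they exist for
   every [phi] in [class_A]; outside of that class the value is unspecified. *)
Definition coef (phi : C -> C) : nat -> C :=
  epsilon (inhabits (fun _ : nat => RtoC 0)) (is_expansion phi).

Definition pqnum (p q : R) (nu : nat) : R := (p ^ nu - q ^ nu) / (p - q).

Definition Upsilon (tau p q : R) (xi kappa : nat) (phi : C -> C) (z : C) : C :=
  (z + Cseries_sum (fun k : nat =>
         let nu := (k + 2)%nat in
         RtoC (pqnum p q nu ^ kappa * (1 + (INR nu - 1) * tau) ^ xi)%R
         * coef phi nu * z ^ nu))%C.

Definition Q_denominator (tau p q : R) (xi kappa : nat) (phi : C -> C)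
    (z : C) : C :=
  (RtoC (1 - tau)%R * Upsilon tau p q xi kappa phi z
   + RtoC tau * Upsilon tau p q xi (kappa + 1) phi z)%C.

Definition Q_numerator (tau p q : R) (xi kappa : nat) (phi : C -> C)
    (z : C) : C :=
  (RtoC (1 - tau)%R * z * C_derive (Upsilon tau p q xi kappa phi) z
   + RtoC tau * z * C_derive (Upsilon tau p q xi (kappa + 1) phi) z)%C.

(* At z = 0 the quotient is 0/0 with removable singularity of value 1 > eta, so
   the condition there is automatic and only z <> 0 is considered. Elsewhere the
   quotient has to be defined, since division by zero returns 0 in [C]. *)
Definition class_Q (p q : R) (xi kappa : nat) (tau eta : R)
    (phi : C -> C) : Prop :=
  class_A phi /\
  forall z : C, Omega z -> z <> RtoC 0 ->
    Q_denominator tau p q xi kappa phi z <> RtoC 0 /\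
    Re (Q_numerator tau p q xi kappa phi z
        / Q_denominator tau p q xi kappa phi z)%C > eta.

Definition class_T (phi : C -> C) : Prop :=
  class_A phi /\
  exists c : nat -> R,
    (forall nu : nat, (2 <= nu)%nat -> 0 <= c nu) /\
    is_expansion phi (fun nu => (- RtoC (c nu))%C).

Definition class_P (p q : R) (xi kappa : nat) (tau eta : R)
    (phi : C -> C) : Prop :=
  class_Q p q xi kappa tau eta phi /\ class_T phi.

Definition phi_extreme (p q : R) (xi kappa : nat) (tau eta : R) (nu : nat)
    (z : C) : C :=
  if Nat.eqb nu 1 then z
  else (z - RtoC ((1 - eta) /
                  (pqnum p q nu ^ kappa * (INR nu - eta)
                   * (1 + (pqnum p q nu - 1) * tau)
                   * (1 + (INR nu - 1) * tau) ^ xi))%R * z ^ nu)%C.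

(* Main.v *)
(** Write [phi z = z - sum c_n z^n] with [c_n >= 0], and let [w_n > 0] be the
    factor multiplying [c_n] in the denominator D of the quotient defining the
    class; then the numerator is [N = z - sum n u_n z^n] and
    [D = z - sum u_n z^n] with [u_n = w_n c_n].
    If [sum (n - eta) u_n <= 1 - eta], the triangle inequality gives
    [|N - D| < (1 - eta) |D|] on the punctured disc, hence [Re (N/D) > eta].
    Conversely, on (0, 1) the function D is real, positive near 0 and never zero,
    so positive; [N > eta D] then reads [sum (n - eta) u_n r^n < (1 - eta) r], and
    [r -> 1] bounds the partial sums.
    The phi_n are chosen so that [mu_n = (n - eta) w_n c_n / (1 - eta)] turns this
    coefficient inequality into [sum_(n >= 2) mu_n <= 1], with [mu_1] the slack. *)
Require Import Defs.
From Stdlib Require Import Reals Ranalysis5 Lra Lia ClassicalEpsilon.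
From Coquelicot Require Import Coquelicot.
Open Scope R_scope.

(** * Complex power series with real coefficients *)

Lemma sum_n_C (a : nat -> C) (n : nat) :
  sum_n (G := C_NormedModule) a n
  = (sum_n (fun k => Re (a k)) n, sum_n (fun k => Im (a k)) n).
Proof.
induction n as [|n IH].
- rewrite !sum_O. apply surjective_pairing.
- rewrite !sum_Sn, IH. reflexivity.
Qed.

(** The uniform structure on [C] is that of a product, so a ball around [l] is a pair of real balls
    and partial sums converge exactly when both components do. *)
Lemma is_series_C (a : nat -> C) (l : C) :
  is_series (K := C_AbsRing) (V := C_NormedModule) a l <->
  is_series (fun k => Re (a k)) (Re l) /\ is_series (fun k => Im (a k)) (Im l).
Proof.
unfold is_series. split.
- intros H.
  assert (H0 := proj1 (filterlim_locally (U := C_UniformSpace) _ l) H).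
  split; apply (filterlim_locally (U := R_UniformSpace)); intros eps;
    generalize (H0 eps); apply filter_imp; intros n Hn;
    rewrite sum_n_C in Hn; [exact (proj1 Hn) | exact (proj2 Hn)].
- intros [H1 H2].
  apply (filterlim_locally (U := C_UniformSpace)). intros eps.
  generalize (filter_and _ _
    (proj1 (filterlim_locally (U := R_UniformSpace) _ (Re l)) H1 eps)
    (proj1 (filterlim_locally (U := R_UniformSpace) _ (Im l)) H2 eps)).
  apply filter_imp. intros n [Hr Hi]. rewrite sum_n_C. split; assumption.
Qed.

Lemma Cseries_sum_unique (a : nat -> C) (l : C) :
  is_series (K := C_AbsRing) (V := C_NormedModule) a l -> Cseries_sum a = l.
Proof.
intros H. apply is_series_C in H. destruct H as [H1 H2].
unfold Cseries_sum. rewrite (is_series_unique _ _ H1), (is_series_unique _ _ H2).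
destruct l; reflexivity.
Qed.

(** [Cseries_sum] has a value even for a divergent series; absolute convergence and completeness of
    [C] make that value the actual sum. *)
Lemma Cseries_sum_correct (a : nat -> C) :
  ex_series (fun k => Cmod (a k)) ->
  is_series (K := C_AbsRing) (V := C_NormedModule) a (Cseries_sum a).
Proof.
intros H.
destruct (ex_series_le (V := C_CompleteNormedModule) a (fun k => Cmod (a k)))
  as [l Hl]; [intros n; apply Rle_refl | exact H |].
rewrite (Cseries_sum_unique a l Hl). exact Hl.
Qed.

(** The triangle inequality bounds every partial sum, and continuity of the norm carries the bound
    to the limit. *)
Lemma Cmod_Cseries_sum_le (a : nat -> C) (b : nat -> R) :
  (forall k, Cmod (a k) <= b k) -> ex_series b ->
  Cmod (Cseries_sum a) <= Series b.
Proof.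
intros Hab Hb.
assert (Ha : ex_series (fun k => Cmod (a k))).
{ apply (ex_series_le (V := R_CompleteNormedModule) _ b); [|exact Hb].
  intros n. unfold norm; simpl. unfold abs; simpl.
  rewrite Rabs_pos_eq; [apply Hab | apply Cmod_ge_0]. }
assert (H := Cseries_sum_correct a Ha).
apply (is_lim_seq_le
  (fun n => norm (sum_n (G := C_NormedModule) a n)) (sum_n b)
  (Cmod (Cseries_sum a)) (Series b)).
- intros n. unfold sum_n.
  eapply Rle_trans; [apply norm_sum_n_m |].
  apply sum_n_m_le. exact Hab.
- exact (filterlim_comp _ _ _ _ _ _ _ _ H
    (filterlim_norm (V := C_NormedModule) (Cseries_sum a))).
- exact (Series_correct b Hb).
Qed.

Lemma Cseries_sum_ext (a b : nat -> C) :
  (forall k, a k = b k) -> Cseries_sum a = Cseries_sum b.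
Proof.
intros H. unfold Cseries_sum.
f_equal; apply Series_ext; intros k; rewrite H; reflexivity.
Qed.

Lemma Cseries_sum_opp (a : nat -> C) :
  Cseries_sum (fun k => - a k)%C = (- Cseries_sum a)%C.
Proof.
unfold Cseries_sum, Copp; simpl. rewrite <- !Series_opp. reflexivity.
Qed.

(* Only the entries of index at least 2 count; [a 0] and [a 1] play no role, here
   and in [disc_conv] and [tail_deriv]. *)
Definition tail_sum (a : nat -> R) (z : C) : C :=
  Cseries_sum (fun k => RtoC (a (k + 2)%nat) * z ^ (k + 2))%C.

Definition disc_conv (a : nat -> R) : Prop :=
  forall r, 0 <= r < 1 -> ex_series (fun k => Rabs (a (k + 2)%nat) * r ^ (k + 2)).

Lemma Cmod_term (x : R) (z : C) (n : nat) :
  Cmod (RtoC x * z ^ n)%C = Rabs x * Cmod z ^ n.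
Proof. rewrite Cmod_mult, Cmod_R, Cmod_pow. reflexivity. Qed.

Lemma ex_series_R_le (a b : nat -> R) :
  (forall k, 0 <= a k <= b k) -> ex_series b -> ex_series a.
Proof.
intros H. apply (ex_series_le (V := R_CompleteNormedModule)).
intros n. unfold norm; simpl. unfold abs; simpl.
rewrite Rabs_pos_eq; apply H.
Qed.

Lemma tail_sum_correct (a : nat -> R) (z : C) :
  disc_conv a -> Omega z ->
  is_series (K := C_AbsRing) (V := C_NormedModule)
    (fun k => RtoC (a (k + 2)%nat) * z ^ (k + 2))%C (tail_sum a z).
Proof.
intros Ha Hz. apply Cseries_sum_correct.
apply (ex_series_ext (fun k => Rabs (a (k + 2)%nat) * Cmod z ^ (k + 2))).
- intros k. symmetry. apply Cmod_term.
- apply Ha. split; [apply Cmod_ge_0 | exact Hz].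
Qed.

Lemma Cmod_tail_sum_le (a : nat -> R) (z : C) :
  disc_conv a -> Omega z ->
  Cmod (tail_sum a z)
  <= Series (fun k => Rabs (a (k + 2)%nat) * Cmod z ^ (k + 2)).
Proof.
intros Ha Hz. apply Cmod_Cseries_sum_le.
- intros k. rewrite Cmod_term. apply Rle_refl.
- apply Ha. split; [apply Cmod_ge_0 | exact Hz].
Qed.

Lemma tail_sum_opp (a : nat -> R) (z : C) :
  tail_sum (fun n => - a n) z = (- tail_sum a z)%C.
Proof.
unfold tail_sum. rewrite <- Cseries_sum_opp. apply Cseries_sum_ext.
intros k. rewrite RtoC_opp. ring.
Qed.

Lemma disc_conv_le (a b : nat -> R) :
  (forall n, (2 <= n)%nat -> Rabs (a n) <= Rabs (b n)) ->
  disc_conv b -> disc_conv a.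
Proof.
intros H Hb r Hr.
apply (ex_series_R_le _ (fun k => Rabs (b (k + 2)%nat) * r ^ (k + 2))); [|exact (Hb r Hr)].
intros k. assert (Hk := H (k + 2)%nat ltac:(lia)).
assert (0 <= r ^ (k + 2)) by (apply pow_le; lra).
split; [apply Rmult_le_pos; [apply Rabs_pos|assumption] |].
apply Rmult_le_compat_r; assumption.
Qed.

(** These are the first two terms of the binomial expansion, with [r^(n-1)] weakened to [r^n] by
    [r <= 1] so that no predecessor appears. *)
Lemma pow_add_ge (r e : R) (n : nat) :
  0 <= r <= 1 -> 0 <= e -> r ^ n + INR n * e * r ^ n <= (r + e) ^ n.
Proof.
intros Hr He. induction n as [|n IH]; [simpl; lra|].
rewrite S_INR. simpl pow.
assert (0 <= r ^ n) by (apply pow_le; lra).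
assert (0 <= INR n) by apply pos_INR.
assert (0 <= INR n * e * r ^ n) by (repeat apply Rmult_le_pos; lra).
assert (Hre := Rmult_le_compat_l (r + e) _ _ ltac:(lra) IH).
assert (r * (e * r ^ n) <= 1 * (e * r ^ n)) by
  (apply Rmult_le_compat_r; [apply Rmult_le_pos|]; lra).
assert (0 <= e * (INR n * e * r ^ n)) by (apply Rmult_le_pos; lra).
nra.
Qed.

(** A larger radius absorbs the factor [n]: with [e] half the distance from [r] to 1,
    [n e r^n <= (r + e)^n] and [r + e] is still below 1. *)
Lemma disc_conv_mult_INR (a : nat -> R) :
  disc_conv a -> disc_conv (fun n => INR n * a n).
Proof.
intros Ha r Hr. set (e := (1 - r) / 2).
apply (ex_series_R_le _
  (fun k => / e * (Rabs (a (k + 2)%nat) * (r + e) ^ (k + 2)))).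
- intros k. set (n := (k + 2)%nat).
  assert (0 <= INR n) by apply pos_INR.
  assert (0 <= r ^ n) by (apply pow_le; lra).
  assert (0 <= Rabs (a n)) by apply Rabs_pos.
  rewrite Rabs_mult, (Rabs_pos_eq (INR n)) by assumption.
  split; [repeat apply Rmult_le_pos; assumption |].
  assert (He : 0 < e) by (unfold e; lra).
  assert (Hp := pow_add_ge r e n ltac:(lra) ltac:(lra)).
  apply (Rmult_le_reg_l e); [exact He|].
  rewrite <- (Rmult_assoc e (/ e)), Rinv_r, Rmult_1_l by lra.
  replace (e * (INR n * Rabs (a n) * r ^ n))
    with (Rabs (a n) * (INR n * e * r ^ n)) by ring.
  apply Rmult_le_compat_l; lra.
- apply (ex_series_scal_l (K := R_AbsRing) (V := R_NormedModule) (/ e)).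
  apply Ha. unfold e; lra.
Qed.

Lemma disc_conv_mult_pow (a : nat -> R) (m : nat) :
  disc_conv a -> disc_conv (fun n => INR n ^ m * a n).
Proof.
intros Ha. induction m as [|m IH].
- apply (disc_conv_le _ a); [|exact Ha]. intros n _. simpl. rewrite Rmult_1_l. lra.
- apply (disc_conv_le _ _) with (2 := disc_conv_mult_INR _ IH).
  intros n _. simpl. right. f_equal. ring.
Qed.

Lemma tail_sum_plus (a b : nat -> R) (z : C) :
  disc_conv a -> disc_conv b -> Omega z ->
  tail_sum (fun n => a n + b n) z = (tail_sum a z + tail_sum b z)%C.
Proof.
intros Ha Hb Hz. apply Cseries_sum_unique.
eapply is_series_ext;
  [| exact (is_series_plus _ _ _ _ (tail_sum_correct a z Ha Hz)
       (tail_sum_correct b z Hb Hz))].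
intros k. simpl. rewrite RtoC_plus. unfold plus; simpl. ring.
Qed.

Lemma tail_sum_scal (a : nat -> R) (x : R) (z : C) :
  disc_conv a -> Omega z ->
  tail_sum (fun n => x * a n) z = (RtoC x * tail_sum a z)%C.
Proof.
intros Ha Hz. apply Cseries_sum_unique.
eapply is_series_ext;
  [| exact (is_series_scal (RtoC x) _ _ (tail_sum_correct a z Ha Hz))].
intros k. simpl. rewrite RtoC_mult. unfold scal; simpl. unfold mult; simpl. ring.
Qed.

(* The defect [e n = w^n - z^n - n z^(n-1) (w-z)] satisfies
   [e (n+1) = w e n + n z^(n-1) (w-z)^2]. *)
Lemma pow_taylor_bound (rho : R) (z w : C) (n : nat) :
  0 <= rho -> Cmod z <= rho -> Cmod w <= rho ->
  rho ^ 2 * Cmod (w ^ n - z ^ n - RtoC (INR n) * z ^ (pred n) * (w - z))%C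
  <= INR n ^ 2 * rho ^ n * Cmod (w - z) ^ 2.
Proof.
intros Hr Hz Hw. set (h := Cmod (w - z)).
assert (Hh : 0 <= h) by apply Cmod_ge_0.
induction n as [|n IH].
- replace (w ^ 0 - z ^ 0 - RtoC (INR 0) * z ^ pred 0 * (w - z))%C with (RtoC 0)
    by (simpl; ring).
  rewrite Cmod_0. simpl. lra.
- set (e := (w ^ n - z ^ n - RtoC (INR n) * z ^ (pred n) * (w - z))%C) in *.
  assert (He : (w ^ S n - z ^ S n - RtoC (INR (S n)) * z ^ pred (S n) * (w - z)
    = w * e + RtoC (INR n) * z ^ (pred n) * ((w - z) * (w - z)))%C).
  { unfold e. rewrite S_INR, RtoC_plus. destruct n as [|n]; simpl; ring. }
  rewrite He.
  assert (Hn : 0 <= INR n) by apply pos_INR.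
  assert (Hz2 : rho * (INR n * Cmod z ^ (pred n)) <= INR n * rho ^ n).
  { destruct n as [|n]; [simpl; lra|]. simpl pred. simpl (rho ^ S n).
    assert (Cmod z ^ n <= rho ^ n) by (apply pow_incr; split; [apply Cmod_ge_0|lra]).
    assert (0 <= rho * INR (S n)) by (apply Rmult_le_pos; lra).
    assert (H1 := Rmult_le_compat_l _ _ _ H0 H). lra. }
  assert (Ht : Cmod (w * e + RtoC (INR n) * z ^ (pred n) * ((w - z) * (w - z)))%C
     <= rho * Cmod e + INR n * Cmod z ^ pred n * h ^ 2).
  { eapply Rle_trans; [apply Cmod_triangle|]. apply Rplus_le_compat.
    - rewrite Cmod_mult. apply Rmult_le_compat_r; [apply Cmod_ge_0|exact Hw].
    - rewrite !Cmod_mult, Cmod_R, Cmod_pow, Rabs_pos_eq by exact Hn.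
      fold h. right; ring. }
  rewrite S_INR. simpl (rho ^ S n).
  assert (H2 : 0 <= rho ^ 2) by (apply pow_le; lra).
  assert (0 <= rho ^ n) by (apply pow_le; lra).
  assert (0 <= h ^ 2) by (apply pow_le; lra).
  apply (Rmult_le_compat_l _ _ _ H2) in Ht.
  eapply Rle_trans; [exact Ht|].
  (* With [h = |w - z|], the two summands contribute [n^2 rho^(n+1) h^2] and [n rho^(n+1) h^2]; the
     induction closes because [n^2 + n <= (n+1)^2]. *)
  assert (H4 := Rmult_le_compat_l _ _ _ Hr IH).
  assert (H5 := Rmult_le_compat_l (rho * h ^ 2) _ _ ltac:(apply Rmult_le_pos; lra) Hz2).
  assert (0 <= rho * rho ^ n * h ^ 2) by (repeat apply Rmult_le_pos; lra).
  assert (0 <= INR n * (rho * rho ^ n * h ^ 2)) by (apply Rmult_le_pos; lra).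
  nra.
Qed.

Definition tail_deriv (a : nat -> R) (z : C) : C :=
  Cseries_sum (fun k => RtoC (a (k + 2)%nat) * (RtoC (INR (k + 2)) * z ^ (k + 1)))%C.

Lemma tail_deriv_correct (a : nat -> R) (z : C) :
  disc_conv a -> Omega z ->
  is_series (K := C_AbsRing) (V := C_NormedModule)
    (fun k => RtoC (a (k + 2)%nat) * (RtoC (INR (k + 2)) * z ^ (k + 1)))%C
    (tail_deriv a z).
Proof.
intros Ha Hz. apply Cseries_sum_correct.
(* Lowering the exponent from [k + 2] to [k + 1] costs a division by the radius. This [r] is
   positive even when [z] is 0, and it dominates [|z|]. *)
set (r := (1 + Cmod z) / 2).
assert (Hz0 := Cmod_ge_0 z). unfold Omega in Hz.
apply (ex_series_R_le _ (fun k => / r * (Rabs (INR (k + 2) * a (k + 2)%nat) * r ^ (k + 2)))).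
- intros k. split; [apply Cmod_ge_0|].
  rewrite !Cmod_mult, !Cmod_R, Cmod_pow, Rabs_mult.
  replace (r ^ (k + 2)) with (r * r ^ (k + 1))
    by (replace (k + 2)%nat with (S (k + 1)) by lia; reflexivity).
  replace (/ r * (Rabs (INR (k + 2)) * Rabs (a (k + 2)%nat) * (r * r ^ (k + 1))))
    with (Rabs (a (k + 2)%nat) * (Rabs (INR (k + 2)) * r ^ (k + 1)))
    by (field; unfold r; lra).
  repeat (apply Rmult_le_compat_l; [apply Rabs_pos|]).
  apply pow_incr. unfold r; lra.
- apply (ex_series_scal_l (K := R_AbsRing) (V := R_NormedModule) (/ r)).
  apply (disc_conv_mult_INR a Ha). unfold r; lra.
Qed.

Lemma tail_deriv_mult (a : nat -> R) (z : C) :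
  disc_conv a -> Omega z ->
  (z * tail_deriv a z)%C = tail_sum (fun n => INR n * a n) z.
Proof.
intros Ha Hz. symmetry. apply Cseries_sum_unique.
eapply is_series_ext;
  [| exact (is_series_scal z _ _ (tail_deriv_correct a z Ha Hz))].
intros k. unfold scal; simpl. unfold mult; simpl.
replace (k + 2)%nat with (S (k + 1)) by lia.
rewrite RtoC_mult. simpl Cpow. ring.
Qed.

Lemma locally_disc (z : C) (rho : R) (P : C -> Prop) :
  Cmod z < rho -> (forall w, Cmod w < rho -> P w) ->
  locally (T := AbsRing_UniformSpace C_AbsRing) z P.
Proof.
intros Hz HP.
assert (Hd : 0 < rho - Cmod z) by lra.
exists (mkposreal _ Hd). intros w Hw. apply HP.
unfold ball in Hw; simpl in Hw. unfold AbsRing_ball in Hw.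
change (Cmod (w - z)%C < rho - Cmod z) in Hw.
replace w with (z + (w - z))%C by ring.
eapply Rle_lt_trans; [apply Cmod_triangle|]. lra.
Qed.

(** Summing [pow_taylor_bound] over all terms bounds the remainder by [M |w - z|^2] with [M] the sum
    of [n^2 |a n| rho^(n-2)], uniformly for [|w| < rho]. The radius [rho] lies strictly between
    [|z|] and 1. *)
Lemma is_derive_tail_sum (a : nat -> R) (z : C) :
  disc_conv a -> Omega z ->
  is_derive (K := C_AbsRing) (V := C_NormedModule) (tail_sum a) z (tail_deriv a z).
Proof.
intros Ha Hz. unfold Omega in Hz.
assert (Hz0 := Cmod_ge_0 z).
set (rho := (1 + Cmod z) / 2).
assert (Hrho : 0 < rho < 1) by (unfold rho; lra).
set (b := fun k => Rabs (INR (k + 2) ^ 2 * a (k + 2)%nat) * rho ^ (k + 2)).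
assert (Hb : ex_series b) by (apply (disc_conv_mult_pow a 2 Ha); lra).
set (M := Series b / rho ^ 2).
assert (Hr2 : 0 < rho ^ 2) by (apply pow_lt; lra).
assert (HM : 0 <= M).
{ apply Rmult_le_pos; [|left; apply Rinv_0_lt_compat, Hr2].
  rewrite <- (Rmult_0_l (Series b)), <- Series_scal_l.
  apply Series_le; [|exact Hb]. intros k. rewrite Rmult_0_l.
  split; [lra|]. apply Rmult_le_pos; [apply Rabs_pos | apply pow_le; lra]. }
assert (Hmain : forall w, Cmod w < rho ->
  Cmod (tail_sum a w - tail_sum a z - (w - z) * tail_deriv a z)%C
  <= M * Cmod (w - z) ^ 2).
{ intros w Hw.
  assert (Hs : Cseries_sum (fun k => RtoC (a (k + 2)%nat) *
      (w ^ (k + 2) - z ^ (k + 2)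
       - RtoC (INR (k + 2)) * z ^ pred (k + 2) * (w - z)))%C
    = (tail_sum a w - tail_sum a z - (w - z) * tail_deriv a z)%C).
  { apply Cseries_sum_unique.
    eapply is_series_ext;
      [| exact (is_series_minus _ _ _ _
           (is_series_minus _ _ _ _ (tail_sum_correct a w Ha ltac:(unfold Omega; lra))
              (tail_sum_correct a z Ha Hz))
           (is_series_scal (w - z)%C _ _ (tail_deriv_correct a z Ha Hz)))].
    intros k. unfold plus, opp, scal; simpl. unfold mult; simpl.
    replace (pred (k + 2)) with (k + 1)%nat by lia. ring. }
  rewrite <- Hs.
  replace (M * Cmod (w - z) ^ 2)
    with (Series (fun k => Cmod (w - z) ^ 2 / rho ^ 2 * b k))
    by (rewrite Series_scal_l; unfold M; field; lra).
  apply Cmod_Cseries_sum_le;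
    [| apply (ex_series_scal_l (K := R_AbsRing) (V := R_NormedModule)), Hb].
  intros k. rewrite Cmod_mult, Cmod_R. unfold b.
  assert (H := pow_taylor_bound rho z w (k + 2) ltac:(lra) ltac:(unfold rho; lra) ltac:(lra)).
  rewrite Rabs_mult, (Rabs_pos_eq (INR _ ^ 2)) by (apply pow_le, pos_INR).
  apply (Rmult_le_reg_l (rho ^ 2)); [exact Hr2|].
  replace (rho ^ 2 * (Cmod (w - z) ^ 2 / rho ^ 2 *
      (INR (k + 2) ^ 2 * Rabs (a (k + 2)%nat) * rho ^ (k + 2))))
    with (Rabs (a (k + 2)%nat) * (INR (k + 2) ^ 2 * rho ^ (k + 2) * Cmod (w - z) ^ 2))
    by (field; lra).
  assert (H1 := Rmult_le_compat_l _ _ _ (Rabs_pos (a (k + 2)%nat)) H). lra. }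
split; [apply is_linear_scal_l|].
intros x Hx. apply (is_filter_lim_locally_unique (V := AbsRing_NormedModule C_AbsRing)) in Hx.
subst x. intros eps.
(* [M] may be 0, hence the denominator [M + 1]. *)
assert (Hd : 0 < eps / (M + 1)) by (apply Rdiv_lt_0_compat; [apply cond_pos | lra]).
apply (filter_imp (fun w : C => Cmod w < rho /\ Cmod (w - z)%C < eps / (M + 1))).
- intros w [Hw Hwz].
  change (Cmod (tail_sum a w - tail_sum a z - (w - z) * tail_deriv a z)%C
    <= eps * Cmod (w - z)%C).
  eapply Rle_trans; [apply Hmain, Hw|].
  assert (H0 := Cmod_ge_0 (w - z)%C).
  assert (M * Cmod (w - z)%C <= eps).
  { apply (Rmult_lt_compat_l (M + 1)) in Hwz; [|lra].
    replace ((M + 1) * (eps / (M + 1))) with (pos eps) in Hwz by (field; lra). lra. }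
  simpl. nra.
- apply filter_and.
  + apply (locally_disc z rho); [unfold rho; lra | trivial].
  + exists (mkposreal _ Hd). intros w Hw. exact Hw.
Qed.

(** * Expansions of functions on the disc *)

(** Strictly outside the disc of convergence the terms do not tend to 0, so a point of convergence
    cannot lie there. *)
Lemma CV_radius_ge (a : nat -> R) (r : R) :
  0 <= r -> ex_series (fun n => a n * r ^ n) -> Rbar_le r (CV_radius a).
Proof.
intros Hr H. apply Rbar_not_lt_le. intros Hlt.
apply (CV_disk_outside a r); [rewrite Rabs_pos_eq; assumption|].
apply ex_series_lim_0, H.
Qed.

(** Padding with zeros at indices 0 and 1 gives a genuine power series [b] that vanishes near 0, to
    which the identity theorem for real power series applies. *)
Lemma tail_series_zero (a : nat -> R) :
  (forall r, Rabs r < 1 -> is_series (fun k => a (k + 2)%nat * r ^ (k + 2)) 0) ->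
  forall k, a (k + 2)%nat = 0.
Proof.
intros H k.
set (b := fun n => match n with O | S O => 0 | _ => a n end).
assert (Hb : forall r, Rabs r < 1 -> is_series (fun n => b n * r ^ n) 0).
{ intros r Hr.
  apply (is_series_decr_n _ 2); [lia|].
  eapply is_series_ext; [| replace (plus _ _) with 0; [exact (H r Hr)|]].
  - intros n. simpl. replace (n + 2)%nat with (S (S n)) by lia. reflexivity.
  - simpl. rewrite sum_Sn, sum_O. unfold plus, opp; simpl. ring. }
assert (HPS : forall r, Rabs r < 1 -> PSeries b r = 0).
{ intros r Hr. apply is_series_unique, Hb, Hr. }
replace (a (k + 2)%nat) with (b (k + 2)%nat)
  by (replace (k + 2)%nat with (S (S k)) by lia; reflexivity).
change 0 with ((fun _ : nat => 0) (k + 2)%nat).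
apply PSeries_ext_recip.
- apply Rbar_lt_le_trans with (Finite (1 / 2)); [simpl; lra|].
  apply CV_radius_ge; [lra|]. exists 0. apply Hb. rewrite Rabs_pos_eq; lra.
- rewrite CV_radius_const_0. exact I.
- exists (mkposreal 1 Rlt_0_1). intros x Hx.
  rewrite PSeries_const_0. apply HPS.
  change (Rabs (x - 0) < 1) in Hx. rewrite Rminus_0_r in Hx. exact Hx.
Qed.

(** At real points of the disc the difference of the two expansions splits into two real power
    series with sum 0, one for the real and one for the imaginary parts of the coefficients. *)
Lemma is_expansion_unique (phi : C -> C) (c d : nat -> C) :
  is_expansion phi c -> is_expansion phi d -> forall k, c (k + 2)%nat = d (k + 2)%nat.
Proof.
intros Hc Hd k.
assert (H : forall r, Rabs r < 1 ->
  is_series (fun k => Re (c (k + 2)%nat - d (k + 2)%nat)%C * r ^ (k + 2)) 0 /\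
  is_series (fun k => Im (c (k + 2)%nat - d (k + 2)%nat)%C * r ^ (k + 2)) 0).
{ intros r Hr.
  assert (HO : Omega (RtoC r)) by (unfold Omega; rewrite Cmod_R; exact Hr).
  assert (H0 := is_series_minus _ _ _ _ (Hc _ HO) (Hd _ HO)).
  apply is_series_C in H0. destruct H0 as [H1 H2].
  replace (Re _) with 0 in H1 by (simpl; ring).
  replace (Im _) with 0 in H2 by (simpl; ring).
  split; [revert H1 | revert H2]; apply is_series_ext; intros n;
    rewrite <- RtoC_pow; simpl; ring. }
assert (Hr := tail_series_zero (fun n => Re (c n - d n)%C) (fun r Hr => proj1 (H r Hr)) k).
assert (Hi := tail_series_zero (fun n => Im (c n - d n)%C) (fun r Hr => proj2 (H r Hr)) k).
simpl in Hr, Hi. apply injective_projections; unfold Re, Im in *; simpl in *; lra.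
Qed.

(** Since [c] witnesses that an expansion exists, the one picked by [epsilon] is also an expansion,
    and uniqueness identifies the two. *)
Lemma coef_eq (phi : C -> C) (c : nat -> C) :
  is_expansion phi c -> forall k, coef phi (k + 2) = c (k + 2)%nat.
Proof.
intros Hc. apply is_expansion_unique with phi; [|exact Hc].
unfold coef. apply epsilon_spec. exists c. exact Hc.
Qed.

(** Convergence at the real point [r] is already absolute, because all terms there have the same
    sign. *)
Lemma disc_conv_of_expansion (phi : C -> C) (c : nat -> R) :
  (forall n, (2 <= n)%nat -> 0 <= c n) ->
  is_expansion phi (fun n => - RtoC (c n))%C -> disc_conv c.
Proof.
intros Hc He r Hr.
assert (HO : Omega (RtoC r)) by (unfold Omega; rewrite Cmod_R, Rabs_pos_eq; lra).
assert (H := proj1 (proj1 (is_series_C _ _) (He _ HO))).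
exists (opp (Re (phi r - r)%C)). apply is_series_opp in H. revert H.
apply is_series_ext. intros k.
rewrite Rabs_pos_eq by (apply Hc; lia). rewrite <- RtoC_pow.
unfold opp; simpl. ring.
Qed.

Lemma expansion_eq (phi : C -> C) (c : nat -> R) (z : C) :
  is_expansion phi (fun n => - RtoC (c n))%C -> Omega z ->
  phi z = (z - tail_sum c z)%C.
Proof.
intros He Hz.
assert (H := Cseries_sum_unique _ _ (He z Hz)).
transitivity (z + (phi z - z))%C; [ring|]. rewrite <- H.
unfold tail_sum, Cminus. f_equal. rewrite <- Cseries_sum_opp.
apply Cseries_sum_ext. intros k. ring.
Qed.

Lemma is_derive_id_C (z : C) :
  is_derive (K := C_AbsRing) (V := C_NormedModule) (fun w => w) z (RtoC 1).
Proof.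
split; [apply is_linear_scal_l|].
intros x _ eps. apply filter_forall. intros w.
change (Cmod (w - x - (w - x) * 1)%C <= eps * Cmod (w - x)%C).
replace (w - x - (w - x) * 1)%C with (RtoC 0) by ring.
rewrite Cmod_0. apply Rmult_le_pos; [left; apply cond_pos | apply Cmod_ge_0].
Qed.

Lemma is_derive_sub_tail_sum (f : C -> C) (a : nat -> R) (z : C) :
  disc_conv a -> Omega z -> (forall w, Omega w -> f w = (w - tail_sum a w)%C) ->
  is_derive (K := C_AbsRing) (V := C_NormedModule) f z (1 - tail_deriv a z)%C.
Proof.
intros Ha Hz Hf.
apply (is_derive_ext_loc (K := C_AbsRing) (V := C_NormedModule)
  (fun w : C => minus (w : C_NormedModule) (tail_sum a w))).
- apply (locally_disc z 1); [exact Hz|]. intros w Hw. symmetry. exact (Hf w Hw).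
- apply (is_derive_minus (K := C_AbsRing) (V := C_NormedModule));
    [apply is_derive_id_C | apply is_derive_tail_sum; assumption].
Qed.

Lemma class_A_of_expansion (phi : C -> C) (c : nat -> R) :
  disc_conv c -> is_expansion phi (fun n => - RtoC (c n))%C -> class_A phi.
Proof.
intros Hc He.
assert (Hd := fun z Hz => is_derive_sub_tail_sum phi c z Hc Hz
  (fun w Hw => expansion_eq phi c w He Hw)).
assert (H0 : Omega (RtoC 0)) by (unfold Omega; rewrite Cmod_0; lra).
(* A null sequence equals its own opposite, so its sum [s] satisfies [s = -s]. *)
assert (Hz : forall a : nat -> C, (forall k, a k = 0) -> Cseries_sum a = 0).
{ intros a Ha. assert (H := Cseries_sum_opp a).
  rewrite (Cseries_sum_ext _ a) in H by (intros k; rewrite Ha; ring).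
  assert (H1 := f_equal fst H). assert (H2 := f_equal snd H). simpl in H1, H2.
  apply injective_projections; simpl; lra. }
split; [intros z Hz'; eexists; apply Hd, Hz' | split].
- rewrite (expansion_eq phi c _ He H0). unfold tail_sum. rewrite Hz; [ring|].
  intros k. replace (k + 2)%nat with (S (S k)) by lia. simpl Cpow. ring.
- rewrite (is_C_derive_unique _ _ _ (Hd _ H0)). unfold tail_deriv. rewrite Hz; [ring|].
  intros k. replace (k + 1)%nat with (S k) by lia. simpl Cpow. ring.
Qed.

(** * The coefficient inequality *)

Lemma tail_sum_ext (a b : nat -> R) (z : C) :
  (forall n, (2 <= n)%nat -> a n = b n) -> tail_sum a z = tail_sum b z.
Proof.
intros H. apply Cseries_sum_ext. intros k. rewrite H by lia. reflexivity.
Qed.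

(** The quotient is [1 + (N - D) / D], a point of the open disc of radius [1 - eta] around 1. The
    strict inequality also rules out [D = 0], where its right side would be 0. *)
Lemma Re_div_gt (eta : R) (N D : C) :
  Cmod (N - D)%C < (1 - eta) * Cmod D -> D <> 0 /\ Re (N / D)%C > eta.
Proof.
intros H.
assert (HD : D <> 0).
{ intros HD. rewrite HD, Cmod_0 in H. assert (H0 := Cmod_ge_0 (N - 0)%C). lra. }
split; [exact HD|].
assert (HD0 : 0 < Cmod D) by (apply Cmod_gt_0, HD).
replace (N / D)%C with (1 + (N - D) / D)%C by (field; exact HD).
assert (Hq : Cmod ((N - D) / D)%C < 1 - eta).
{ rewrite Cmod_div by exact HD. apply Rlt_div_l; assumption. }
assert (Hre := re_le_Cmod ((N - D) / D)%C). apply Rabs_le_between in Hre.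
change (1 + Re ((N - D) / D)%C > eta). lra.
Qed.

Lemma Re_quotient_gt_of_sum_le (u : nat -> R) (eta : R) (z : C) :
  0 <= eta < 1 -> disc_conv u -> (forall n, (2 <= n)%nat -> 0 <= u n) ->
  ex_series (fun k => (INR (k + 2) - eta) * u (k + 2)%nat) ->
  Series (fun k => (INR (k + 2) - eta) * u (k + 2)%nat) <= 1 - eta ->
  Omega z -> z <> 0 ->
  (z - tail_sum u z)%C <> 0 /\
  Re ((z - tail_sum (fun n => INR n * u n)%R z) / (z - tail_sum u z))%C > eta.
Proof.
intros Heta Hu Hpos Hex Hle Hz Hz0. apply Re_div_gt.
set (r := Cmod z). assert (Hr : 0 < r < 1) by (split; [apply Cmod_gt_0, Hz0 | exact Hz]).
assert (Hnu := disc_conv_mult_INR u Hu).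
assert (Hn1 : forall n, (2 <= n)%nat -> 0 <= INR n * u n + - u n).
{ intros n Hn. assert (2 <= INR n) by (apply (le_INR 2); exact Hn).
  assert (H0 := Hpos n Hn).
  assert (1 * u n <= INR n * u n) by (apply Rmult_le_compat_r; lra). lra. }
assert (Hd : disc_conv (fun n => INR n * u n + - u n)).
{ apply disc_conv_le with (2 := Hnu). intros n Hn.
  assert (H0 := Hpos n Hn). specialize (Hn1 n Hn). rewrite !Rabs_pos_eq; lra. }
assert (Hou : disc_conv (fun n => - u n)).
{ apply disc_conv_le with (2 := Hu). intros n _. rewrite Rabs_Ropp. lra. }
(* Here [N - D] is minus the tail with coefficients [(n - 1) u n], written as a sum so that it
   splits by [tail_sum_plus]. *)
replace (z - tail_sum (fun n => INR n * u n)%R z - (z - tail_sum u z))%C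
  with (- tail_sum (fun n => INR n * u n + - u n)%R z)%C
  by (rewrite tail_sum_plus, tail_sum_opp by assumption; ring).
rewrite Cmod_opp.
set (A := Series (fun k => (INR (k + 2) * u (k + 2)%nat + - u (k + 2)%nat) * r ^ (k + 2))).
set (B := Series (fun k => u (k + 2)%nat * r ^ (k + 2))).
assert (HeA : ex_series (fun k => (INR (k + 2) * u (k + 2)%nat + - u (k + 2)%nat) * r ^ (k + 2))).
{ assert (H := Hd r ltac:(lra)). revert H. apply ex_series_ext. intros k.
  rewrite Rabs_pos_eq; [reflexivity|]. apply Hn1; lia. }
assert (HeB : ex_series (fun k => u (k + 2)%nat * r ^ (k + 2))).
{ assert (H := Hu r ltac:(lra)). revert H. apply ex_series_ext. intros k.
  rewrite Rabs_pos_eq; [reflexivity|]. apply Hpos; lia. }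
assert (HA : Cmod (tail_sum (fun n => INR n * u n + - u n)%R z) <= A).
{ eapply Rle_trans; [apply Cmod_tail_sum_le; assumption|].
  right. apply Series_ext. intros k. fold r. rewrite Rabs_pos_eq; [reflexivity|].
  apply Hn1; lia. }
assert (HB : r - B <= Cmod (z - tail_sum u z)%C).
{ assert (H1 : Cmod (tail_sum u z) <= B).
  { eapply Rle_trans; [apply Cmod_tail_sum_le; assumption|].
    right. apply Series_ext. intros k. fold r. rewrite Rabs_pos_eq; [reflexivity|].
    apply Hpos; lia. }
  assert (H2 := Cmod_triangle (z - tail_sum u z)%C (tail_sum u z)).
  replace (z - tail_sum u z + tail_sum u z)%C with z in H2 by ring.
  fold r in H2. lra. }
(* The left side is the sum of [(n - eta) u n r^n]. All exponents are at least 2, so [r^2] factors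
   out, and [r^2 < r] later supplies the strict inequality. *)
assert (HAB : A + (1 - eta) * B <= r ^ 2 * (1 - eta)).
{ unfold A, B. rewrite <- Series_scal_l, <- Series_plus;
    [| exact HeA | apply (ex_series_scal_l (K := R_AbsRing) (V := R_NormedModule)), HeB].
  eapply Rle_trans; [| apply Rmult_le_compat_l; [apply pow_le; lra | exact Hle]].
  rewrite <- Series_scal_l. apply Series_le;
    [| apply (ex_series_scal_l (K := R_AbsRing) (V := R_NormedModule)), Hex].
  intros k.
  replace ((INR (k + 2) * u (k + 2)%nat + - u (k + 2)%nat) * r ^ (k + 2) +
    (1 - eta) * (u (k + 2)%nat * r ^ (k + 2)))
    with (((INR (k + 2) - eta) * u (k + 2)%nat) * r ^ (k + 2)) by ring.
  assert (H2 : 2 <= INR (k + 2)) by (apply (le_INR 2); lia).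
  assert (H0 := Hpos (k + 2)%nat ltac:(lia)).
  assert (H3 : 0 <= (INR (k + 2) - eta) * u (k + 2)%nat) by (apply Rmult_le_pos; lra).
  split; [apply Rmult_le_pos; [exact H3 | apply pow_le; lra]|].
  rewrite (Rmult_comm (r ^ 2)). apply Rmult_le_compat_l; [exact H3|].
  rewrite pow_add. rewrite <- (Rmult_1_l (r ^ 2)) at 2.
  apply Rmult_le_compat_r; [apply pow_le; lra|].
  rewrite <- (pow1 k). apply pow_incr; lra. }
assert (Hfin : r ^ 2 * (1 - eta) < r * (1 - eta))
  by (apply Rmult_lt_compat_r; nra).
assert ((1 - eta) * (r - B) <= (1 - eta) * Cmod (z - tail_sum u z)%C)
  by (apply Rmult_le_compat_l; lra).
lra.
Qed.

(** * Necessity of the inequality: restriction to the real interval (0, 1) *)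

Definition real_tail (a : nat -> R) (r : R) : R :=
  Series (fun k => a (k + 2)%nat * r ^ (k + 2)).

Lemma ex_real_tail (a : nat -> R) (r : R) :
  disc_conv a -> 0 <= r < 1 -> ex_series (fun k => a (k + 2)%nat * r ^ (k + 2)).
Proof.
intros Ha Hr. apply ex_series_Rabs.
assert (H := Ha r Hr). revert H. apply ex_series_ext. intros k.
rewrite Rabs_mult, (Rabs_pos_eq (r ^ _)) by (apply pow_le; lra). reflexivity.
Qed.

Lemma tail_sum_real (a : nat -> R) (r : R) :
  disc_conv a -> 0 <= r < 1 -> tail_sum a r = RtoC (real_tail a r).
Proof.
intros Ha Hr. apply Cseries_sum_unique, is_series_C.
assert (H := Series_correct _ (ex_real_tail a r Ha Hr)).
split.
- revert H. apply is_series_ext. intros k. rewrite <- RtoC_pow, <- RtoC_mult. reflexivity.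
- apply (is_series_ext (fun k => 0 * (a (k + 2)%nat * r ^ (k + 2)))).
  + intros k. rewrite <- RtoC_pow, <- RtoC_mult. simpl. ring.
  + replace (Im _) with (scal (K := R_AbsRing) (V := R_NormedModule) 0 (real_tail a r))
      by (unfold scal; simpl; unfold mult; simpl; ring).
    apply (is_series_scal (K := R_AbsRing) (V := R_NormedModule) 0 _ _ H).
Qed.

(** The tail is [x^2] times a power series converging at [(1 + r) / 2], so [r] lies strictly inside
    its disc of convergence. *)
Lemma continuous_real_tail (a : nat -> R) (r : R) :
  disc_conv a -> 0 <= r < 1 -> continuity_pt (real_tail a) r.
Proof.
intros Ha Hr.
apply (continuity_pt_ext (fun x => x ^ 2 * PSeries (fun k => a (k + 2)%nat) x)).
{ intros x. unfold PSeries, real_tail. rewrite <- Series_scal_l.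
  apply Series_ext. intros k. rewrite pow_add. ring. }
apply continuity_pt_mult; [apply derivable_continuous_pt, derivable_pt_pow|].
apply (PSeries_continuity (fun k => a (k + 2)%nat)).
apply Rbar_lt_le_trans with (Finite ((1 + r) / 2)); [simpl; rewrite Rabs_pos_eq; lra|].
apply CV_radius_ge; [lra|].
assert (H := ex_real_tail a ((1 + r) / 2) Ha ltac:(lra)).
apply (ex_series_scal_l (K := R_AbsRing) (V := R_NormedModule) (/ ((1 + r) / 2) ^ 2)) in H.
revert H. apply ex_series_ext. intros k. unfold scal; simpl; unfold mult; simpl.
rewrite pow_add. field. lra.
Qed.

(* [r - real_tail u r] is positive near [0] and has no zero. *)
Lemma real_tail_lt (u : nat -> R) :
  disc_conv u -> (forall n, (2 <= n)%nat -> 0 <= u n) ->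
  (forall r, 0 < r < 1 -> r - real_tail u r <> 0) ->
  forall r, 0 < r < 1 -> real_tail u r < r.
Proof.
intros Hu Hpos Hne.
set (G := real_tail u (1 / 2)).
assert (HG : 0 <= G).
{ unfold G, real_tail.
  rewrite <- (Rmult_0_l (Series (fun k => u (k + 2)%nat * (1 / 2) ^ (k + 2)))),
    <- Series_scal_l.
  apply Series_le; [|apply ex_real_tail; [exact Hu|lra]].
  intros k. rewrite Rmult_0_l. split; [lra|].
  apply Rmult_le_pos; [apply Hpos; lia | apply pow_le; lra]. }
(* Comparison with the terms at radius 1/2 gives [real_tail u r <= 4 r^2 G] for small [r]; the
   choice of [r0] forces [4 r G < 1], hence a value below [r]. *)
set (r0 := / (4 * (G + 1))).
assert (H0 : 0 < 4 * (G + 1)) by lra.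
assert (Hr0 : 0 < r0) by (apply Rinv_0_lt_compat, H0).
assert (Hr0' : r0 * (4 * (G + 1)) = 1) by (apply Rinv_l; lra).
assert (Hr04 : r0 <= 1 / 4) by nra.
assert (Hsmall : forall r, 0 < r <= r0 -> real_tail u r < r).
{ intros r Hr.
  assert (H1 : real_tail u r <= (2 * r) ^ 2 * G).
  { unfold G, real_tail. rewrite <- Series_scal_l. apply Series_le;
      [| apply (ex_series_scal_l (K := R_AbsRing) (V := R_NormedModule)), ex_real_tail;
         [exact Hu|lra]].
    intros k. assert (Huk := Hpos (k + 2)%nat ltac:(lia)).
    split; [apply Rmult_le_pos; [exact Huk | apply pow_le; lra]|].
    replace ((2 * r) ^ 2 * (u (k + 2)%nat * (1 / 2) ^ (k + 2)))
      with (u (k + 2)%nat * (r ^ 2 * (1 / 2) ^ k)) by (rewrite pow_add; field).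
    apply Rmult_le_compat_l; [exact Huk|].
    rewrite pow_add, Rmult_comm. apply Rmult_le_compat_l; [apply pow_le; lra|].
    apply pow_incr; lra. }
  assert (4 * r * G < 1) by nra. nra. }
intros r Hr.
destruct (Rle_or_lt r r0) as [Hle|Hlt]; [apply Hsmall; lra|].
apply Rnot_le_lt. intros Hge.
assert (Hr_ne := Hne r Hr). assert (Hs := Hsmall r0 ltac:(lra)).
(* The function [real_tail u x - x] is negative at [r0] and would be positive at [r], so it would
   vanish in between, against [Hne]. *)
destruct (IVT_interv (fun x => real_tail u x - x) r0 r) as [x [Hx Hx0]];
  [| lra | lra | lra | apply (Hne x); lra].
intros x Hx. apply continuity_pt_minus; [|apply derivable_continuous_pt, derivable_pt_id].
apply continuous_real_tail; [exact Hu | lra].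
Qed.

(** This is the passage [r -> 1] made explicit: if [P > b], the hypothesis fails at [r = 1 - t] for
    a small [t], by Bernoulli's inequality. *)
Lemma Rle_of_pow_le (P b : R) (m : nat) :
  0 <= b -> (forall r, 0 < r < 1 -> P * r ^ m <= b) -> P <= b.
Proof.
intros Hb H.
destruct (Rle_or_lt P b) as [|Hlt]; [assumption|exfalso].
assert (Hm := pos_INR m).
(* This [t] is below 1 and satisfies [P m t < P - b], whereas Bernoulli yields
   [P (1 - m t) <= b]. *)
set (t := (P - b) / ((INR m + 1) * (P + 1))).
assert (Hden : 0 < (INR m + 1) * (P + 1)) by (apply Rmult_lt_0_compat; lra).
assert (Ht : t * ((INR m + 1) * (P + 1)) = P - b) by (unfold t; field; lra).
assert (Ht0 : 0 < t) by (apply Rdiv_lt_0_compat; lra).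
assert (Ht1 : t < 1).
{ apply (Rmult_lt_reg_r ((INR m + 1) * (P + 1))); [exact Hden|]. nra. }
assert (Hbern : 1 - INR m * t <= (1 - t) ^ m).
{ clear - Ht0 Ht1. clearbody t. induction m as [|m IH]; [simpl; lra|].
  rewrite S_INR. simpl. assert (0 <= INR m) by apply pos_INR.
  assert (H1 := Rmult_le_compat_l (1 - t) _ _ ltac:(lra) IH).
  assert (0 <= INR m * t * t) by (repeat apply Rmult_le_pos; lra). nra. }
specialize (H (1 - t) ltac:(lra)).
assert (P * (1 - INR m * t) <= b).
{ eapply Rle_trans; [|exact H]. apply Rmult_le_compat_l; lra. }
assert (P * (INR m * t) < t * ((INR m + 1) * (P + 1))).
{ replace (t * ((INR m + 1) * (P + 1))) with (P * (INR m * t) + t * (INR m + P + 1)) by ring.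
  assert (0 < t * (INR m + P + 1)) by (apply Rmult_lt_0_compat; lra). lra. }
lra.
Qed.

Lemma sum_le_of_Re_quotient_gt (u : nat -> R) (eta : R) :
  0 <= eta < 1 -> disc_conv u -> (forall n, (2 <= n)%nat -> 0 <= u n) ->
  (forall z : C, Omega z -> z <> 0 ->
    (z - tail_sum u z)%C <> 0 /\
    Re ((z - tail_sum (fun n => INR n * u n)%R z) / (z - tail_sum u z))%C > eta) ->
  ex_series (fun k => (INR (k + 2) - eta) * u (k + 2)%nat) /\
  Series (fun k => (INR (k + 2) - eta) * u (k + 2)%nat) <= 1 - eta.
Proof.
intros Heta Hu Hpos HQ.
assert (Hnu := disc_conv_mult_INR u Hu).
assert (HQr : forall r, 0 < r < 1 -> r - real_tail u r <> 0 /\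
   (r - real_tail (fun n => INR n * u n) r) / (r - real_tail u r) > eta).
{ intros r Hr.
  destruct (HQ (RtoC r)) as [H1 H2].
  - unfold Omega. rewrite Cmod_R, Rabs_pos_eq; lra.
  - intros H. apply RtoC_inj in H. lra.
  - rewrite !tail_sum_real in * by (try assumption; lra).
    rewrite <- !RtoC_minus in *.
    assert (Hne : r - real_tail u r <> 0) by (intros H; apply H1; rewrite H; reflexivity).
    rewrite <- RtoC_div in H2 by exact Hne. split; assumption. }
assert (Hlt := real_tail_lt u Hu Hpos (fun r Hr => proj1 (HQr r Hr))).
set (v := fun k => (INR (k + 2) - eta) * u (k + 2)%nat).
assert (Hv : forall k, 0 <= v k).
{ intros k. assert (2 <= INR (k + 2)) by (apply (le_INR 2); lia).
  apply Rmult_le_pos; [lra | apply Hpos; lia]. }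
assert (Hbound : forall r, 0 < r < 1 ->
  is_series (fun k => v k * r ^ (k + 2))
    (real_tail (fun n => INR n * u n) r - eta * real_tail u r) /\
  real_tail (fun n => INR n * u n) r - eta * real_tail u r <= 1 - eta).
{ intros r Hr. split.
  - assert (H1 := Series_correct _ (ex_real_tail _ r Hnu ltac:(lra))).
    assert (H2 := is_series_scal (K := R_AbsRing) (V := R_NormedModule) eta _ _
                    (Series_correct _ (ex_real_tail _ r Hu ltac:(lra)))).
    eapply is_series_ext; [|exact (is_series_minus _ _ _ _ H1 H2)].
    intros k. unfold v, plus, opp, scal; simpl; unfold mult; simpl. ring.
  (* Positivity of the denominator, given by [Hlt], allows clearing it; [r < 1] then replaces
     [(1 - eta) r] by [1 - eta]. *)
  - destruct (HQr r Hr) as [_ H]. specialize (Hlt r Hr).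
    apply Rgt_lt in H. apply Rlt_div_r in H; [|lra]. nra. }
(* For [k <= n] each factor [r^(k+2)] is at least [r^(n+2)], so the partial sum times [r^(n+2)]
   stays below the full series at [r]. Letting [r] tend to 1 for fixed [n] needs no interchange of
   limits. *)
assert (Hpart : forall n, sum_n v n <= 1 - eta).
{ intros n. apply (Rle_of_pow_le _ _ (n + 2)); [lra|]. intros r Hr.
  destruct (Hbound r Hr) as [H1 H2]. eapply Rle_trans; [|exact H2].
  apply Rle_trans with (sum_n (fun k => v k * r ^ (k + 2)) n).
  - clear - Hr Hv. induction n as [|n IH]; [rewrite !sum_O; apply Rle_refl|].
    rewrite !sum_Sn, Rmult_plus_distr_r. apply Rplus_le_compat_r.
    eapply Rle_trans; [|exact IH].
    assert (0 <= sum_n v n * r ^ (n + 2)).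
    { apply Rmult_le_pos; [|apply pow_le; lra].
      clear - Hv. induction n as [|n IH]; [rewrite sum_O; apply Hv|].
      rewrite sum_Sn. apply Rplus_le_le_0_compat; [exact IH | apply Hv]. }
    change (r ^ (S n + 2)) with (r * r ^ (n + 2)). nra.
  - apply (is_lim_seq_incr_compare (sum_n (fun k => v k * r ^ (k + 2)))); [exact H1|].
    intros m. rewrite sum_Sn. unfold plus; simpl.
    assert (0 <= v (S m) * r ^ (S m + 2))
      by (apply Rmult_le_pos; [apply Hv | apply pow_le; lra]). simpl in *; lra. }
(* Partial sums of nonnegative terms increase, so their common bound yields convergence as well as
   the estimate. *)
destruct (ex_finite_lim_seq_incr (sum_n v) (1 - eta)) as [l Hl]; [|exact Hpart|].
{ intros n. rewrite sum_Sn. unfold plus; simpl. specialize (Hv (S n)). lra. }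
assert (Hs : is_series v l) by exact Hl.
split; [exists l; exact Hs|].
rewrite (is_series_unique _ _ Hs).
exact (is_lim_seq_le _ _ l (1 - eta) Hpart Hl (is_lim_seq_const _)).
Qed.

(** * The operator and the extreme functions *)

Lemma pqnum_S (p q : R) (n : nat) :
  p <> q -> pqnum p q (S n) = p * pqnum p q n + q ^ n.
Proof. intros H. unfold pqnum. simpl. field. lra. Qed.

(** By the recurrence [pqnum_S] each step multiplies by [p < 1] and adds [q^n], which lies in (0,
    1]. Positivity makes the weights positive, and the upper bound keeps them polynomial in [n]. *)
Lemma pqnum_bounds (p q : R) (n : nat) :
  0 < p -> p < q -> q <= 1 -> (1 <= n)%nat -> 0 < pqnum p q n <= INR n.
Proof.
intros hp hpq hq Hn. destruct n as [|n]; [lia|]. clear Hn.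
induction n as [|n IH].
- rewrite pqnum_S by lra. unfold pqnum. simpl. lra.
- rewrite pqnum_S, (S_INR (S n)) by lra.
  assert (0 < q ^ S n) by (apply pow_lt; lra).
  assert (q ^ S n <= 1) by (rewrite <- (pow1 (S n)); apply pow_incr; lra).
  nra.
Qed.

(** This serves to collect the linear terms [mu_n z] of the convex combination. *)
Lemma is_series_RtoC_mult (m : nat -> R) (l : R) (z : C) :
  is_series m l ->
  is_series (K := C_AbsRing) (V := C_NormedModule)
    (fun k => RtoC (m k) * z)%C (RtoC l * z)%C.
Proof.
intros H. apply is_series_C. unfold Re, Im. simpl. split.
- replace (l * fst z - 0 * snd z) with (fst z * l) by ring.
  generalize (is_series_scal (K := R_AbsRing) (V := R_NormedModule) (fst z) _ _ H).
  apply is_series_ext. intros k. unfold scal; simpl; unfold mult; simpl.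
  ring.
- replace (l * snd z + 0 * fst z) with (snd z * l) by ring.
  generalize (is_series_scal (K := R_AbsRing) (V := R_NormedModule) (snd z) _ _ H).
  apply is_series_ext. intros k. unfold scal; simpl; unfold mult; simpl. ring.
Qed.

Definition upsilon_weight (tau p q : R) (xi kappa nu : nat) : R :=
  pqnum p q nu ^ kappa * (1 + (INR nu - 1) * tau) ^ xi.

(** Both bases are positive and at most [n], the second because [tau <= 1]. Polynomial growth
    preserves convergence on the disc. *)
Lemma upsilon_weight_bounds (p q tau : R) (xi kappa n : nat) :
  0 < p -> p < q -> q <= 1 -> 0 <= tau <= 1 -> (1 <= n)%nat ->
  0 < upsilon_weight tau p q xi kappa n <= INR n ^ (kappa + xi).
Proof.
intros hp hpq hq ht Hn.
assert (Hpq := pqnum_bounds p q n hp hpq hq Hn).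
assert (H1 : 1 <= INR n) by (apply (le_INR 1); exact Hn).
assert (H2 : 1 <= 1 + (INR n - 1) * tau <= INR n) by nra.
unfold upsilon_weight. rewrite pow_add. split.
- apply Rmult_lt_0_compat; apply pow_lt; lra.
- apply Rmult_le_compat; try (apply pow_le; lra); apply pow_incr; lra.
Qed.

Lemma disc_conv_upsilon (p q tau : R) (xi kappa : nat) (c : nat -> R) :
  0 < p -> p < q -> q <= 1 -> 0 <= tau <= 1 -> disc_conv c ->
  disc_conv (fun n => upsilon_weight tau p q xi kappa n * c n).
Proof.
intros hp hpq hq ht Hc.
apply disc_conv_le with (2 := disc_conv_mult_pow c (kappa + xi) Hc).
intros n Hn. assert (Hw := upsilon_weight_bounds p q tau xi kappa n hp hpq hq ht ltac:(lia)).
rewrite !Rabs_mult. apply Rmult_le_compat_r; [apply Rabs_pos|].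
rewrite !Rabs_pos_eq; lra.
Qed.

Lemma Upsilon_eq (p q tau : R) (xi kappa : nat) (phi : C -> C) (c : nat -> R) (z : C) :
  is_expansion phi (fun n => - RtoC (c n))%C ->
  Upsilon tau p q xi kappa phi z
  = (z - tail_sum (fun n => upsilon_weight tau p q xi kappa n * c n)%R z)%C.
Proof.
intros He. unfold Upsilon, Cminus. f_equal. rewrite <- tail_sum_opp.
apply Cseries_sum_ext. intros k. cbv zeta.
rewrite (coef_eq phi _ He). unfold upsilon_weight.
rewrite RtoC_opp, !RtoC_mult. ring.
Qed.

(* The factor by which the coefficients of [phi] are multiplied in the
   denominator [(1-tau) Upsilon^kappa + tau Upsilon^(kappa+1)]. *)
Definition den_weight (tau p q : R) (xi kappa nu : nat) : R :=
  upsilon_weight tau p q xi kappa nu * (1 + (pqnum p q nu - 1) * tau).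

Lemma den_weight_split (tau p q : R) (xi kappa nu : nat) :
  den_weight tau p q xi kappa nu
  = (1 - tau) * upsilon_weight tau p q xi kappa nu
    + tau * upsilon_weight tau p q xi (kappa + 1) nu.
Proof. unfold den_weight, upsilon_weight. rewrite pow_add. ring. Qed.

(** The last factor equals [(1 - tau) + tau [n]], a convex combination of 1 and [[n] > 0]; it is
    positive even when [[n] < 1]. *)
Lemma den_weight_pos (p q tau : R) (xi kappa n : nat) :
  0 < p -> p < q -> q <= 1 -> 0 <= tau <= 1 -> (1 <= n)%nat ->
  0 < den_weight tau p q xi kappa n.
Proof.
intros hp hpq hq ht Hn.
assert (H1 := pqnum_bounds p q n hp hpq hq Hn).
apply Rmult_lt_0_compat; [apply upsilon_weight_bounds; assumption|]. nra.
Qed.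

Lemma disc_conv_scal (a : nat -> R) (x : R) :
  disc_conv a -> disc_conv (fun n => x * a n).
Proof.
intros Ha r Hr.
apply (ex_series_ext (fun k => Rabs x * (Rabs (a (k + 2)%nat) * r ^ (k + 2)))).
- intros k. rewrite Rabs_mult. symmetry. apply Rmult_assoc.
- apply (ex_series_scal_l (K := R_AbsRing) (V := R_NormedModule)), Ha, Hr.
Qed.

Lemma disc_conv_plus (a b : nat -> R) :
  disc_conv a -> disc_conv b -> disc_conv (fun n => a n + b n).
Proof.
intros Ha Hb r Hr.
apply (ex_series_R_le _ (fun k => Rabs (a (k + 2)%nat) * r ^ (k + 2)
                                  + Rabs (b (k + 2)%nat) * r ^ (k + 2))).
- intros k. assert (0 <= r ^ (k + 2)) by (apply pow_le; lra).
  split; [apply Rmult_le_pos; [apply Rabs_pos | assumption]|].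
  rewrite <- Rmult_plus_distr_r. apply Rmult_le_compat_r; [assumption | apply Rabs_triang].
- apply (ex_series_plus (K := R_AbsRing) (V := R_NormedModule)); [apply Ha | apply Hb]; exact Hr.
Qed.

Lemma tail_sum_lin_comb (a b : nat -> R) (x y : R) (z : C) :
  disc_conv a -> disc_conv b -> Omega z ->
  tail_sum (fun n => x * a n + y * b n)%R z
  = (RtoC x * tail_sum a z + RtoC y * tail_sum b z)%C.
Proof.
intros Ha Hb Hz.
rewrite (tail_sum_plus (fun n => x * a n)%R (fun n => y * b n)%R), !tail_sum_scal;
  try assumption; try reflexivity; apply disc_conv_scal; assumption.
Qed.

Lemma Q_denominator_eq (p q tau : R) (xi kappa : nat) (phi : C -> C) (c : nat -> R) (z : C) :
  0 < p -> p < q -> q <= 1 -> 0 <= tau <= 1 ->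
  disc_conv c -> is_expansion phi (fun n => - RtoC (c n))%C -> Omega z ->
  Q_denominator tau p q xi kappa phi z
  = (z - tail_sum (fun n => den_weight tau p q xi kappa n * c n)%R z)%C.
Proof.
intros hp hpq hq ht Hc He Hz.
unfold Q_denominator. rewrite !(Upsilon_eq p q tau xi _ phi c z He).
rewrite (tail_sum_ext (fun n => den_weight tau p q xi kappa n * c n)%R
  (fun n => (1 - tau) * (upsilon_weight tau p q xi kappa n * c n)
            + tau * (upsilon_weight tau p q xi (kappa + 1) n * c n))%R)
  by (intros n _; rewrite den_weight_split; ring).
rewrite tail_sum_lin_comb by (try apply disc_conv_upsilon; assumption).
rewrite RtoC_minus. ring.
Qed.

Lemma Q_numerator_eq (p q tau : R) (xi kappa : nat) (phi : C -> C) (c : nat -> R) (z : C) :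
  0 < p -> p < q -> q <= 1 -> 0 <= tau <= 1 ->
  disc_conv c -> is_expansion phi (fun n => - RtoC (c n))%C -> Omega z ->
  Q_numerator tau p q xi kappa phi z
  = (z - tail_sum (fun n => INR n * (den_weight tau p q xi kappa n * c n))%R z)%C.
Proof.
intros hp hpq hq ht Hc He Hz.
assert (HD : forall m, disc_conv (fun n => upsilon_weight tau p q xi m n * c n))
  by (intros m; apply disc_conv_upsilon; assumption).
(* The operator [z d/dz] multiplies the coefficient of index [n] by [n]. *)
assert (Hder : forall m, (z * C_derive (Upsilon tau p q xi m phi) z)%C
  = (z - tail_sum (fun n => INR n * (upsilon_weight tau p q xi m n * c n))%R z)%C).
{ intros m.
  rewrite (is_C_derive_unique _ _ _ (is_derive_sub_tail_sum _ _ z (HD m) Hz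
    (fun w _ => Upsilon_eq p q tau xi m phi c w He))).
  rewrite <- (tail_deriv_mult _ z (HD m) Hz). ring. }
unfold Q_numerator. rewrite <- !Cmult_assoc, !Hder.
rewrite (tail_sum_ext (fun n => INR n * (den_weight tau p q xi kappa n * c n))%R
  (fun n => (1 - tau) * (INR n * (upsilon_weight tau p q xi kappa n * c n))
            + tau * (INR n * (upsilon_weight tau p q xi (kappa + 1) n * c n)))%R)
  by (intros n _; rewrite den_weight_split; ring).
rewrite tail_sum_lin_comb by (try apply disc_conv_mult_INR; auto).
rewrite RtoC_minus. ring.
Qed.

(** The two directions of the coefficient inequality are applied to the coefficients [u n] of the
    denominator, which inherit nonnegativity from [c] since the weights are positive. *)
Lemma class_Q_iff_sum_le (p q eta tau : R) (kappa xi : nat) (phi : C -> C) (c : nat -> R) :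
  0 < p -> p < q -> q <= 1 -> 0 <= eta < 1 -> 0 <= tau <= 1 ->
  (forall n, (2 <= n)%nat -> 0 <= c n) ->
  is_expansion phi (fun n => - RtoC (c n))%C ->
  class_Q p q xi kappa tau eta phi <->
  ex_series (fun k => (INR (k + 2) - eta)
      * (den_weight tau p q xi kappa (k + 2) * c (k + 2)%nat)) /\
  Series (fun k => (INR (k + 2) - eta)
      * (den_weight tau p q xi kappa (k + 2) * c (k + 2)%nat)) <= 1 - eta.
Proof.
intros hp hpq hq heta ht Hpos He.
assert (Hc := disc_conv_of_expansion phi c Hpos He).
set (u := fun n => den_weight tau p q xi kappa n * c n).
assert (Hu : disc_conv u).
{ intros r Hr.
  assert (H := disc_conv_plus _ _
    (disc_conv_scal _ (1 - tau) (disc_conv_upsilon p q tau xi kappa c hp hpq hq ht Hc))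
    (disc_conv_scal _ tau (disc_conv_upsilon p q tau xi (kappa + 1) c hp hpq hq ht Hc)) r Hr).
  revert H. apply ex_series_ext. intros k. unfold u.
  rewrite den_weight_split. do 2 f_equal. ring. }
assert (Hupos : forall n, (2 <= n)%nat -> 0 <= u n).
{ intros n Hn. apply Rmult_le_pos; [left; apply den_weight_pos; (assumption || lia) | auto]. }
split.
- intros [_ HQ]. apply (sum_le_of_Re_quotient_gt u eta heta Hu Hupos).
  intros z Hz Hz0. specialize (HQ z Hz Hz0).
  rewrite (Q_denominator_eq p q tau xi kappa phi c), (Q_numerator_eq p q tau xi kappa phi c)
    in HQ by assumption. exact HQ.
- intros [Hex Hle]. split; [apply (class_A_of_expansion phi c); assumption|].
  intros z Hz Hz0.
  rewrite (Q_denominator_eq p q tau xi kappa phi c), (Q_numerator_eq p q tau xi kappa phi c)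
    by assumption.
  exact (Re_quotient_gt_of_sum_le u eta z heta Hu Hupos Hex Hle Hz Hz0).
Qed.

(** This is the largest coefficient of index [nu] that the coefficient inequality allows when all
    others vanish. *)
Definition extreme_coef (p q : R) (xi kappa : nat) (tau eta : R) (nu : nat) : R :=
  (1 - eta) / ((INR nu - eta) * den_weight tau p q xi kappa nu).

Lemma phi_extreme_ge2 (p q : R) (xi kappa : nat) (tau eta : R) (k : nat) (z : C) :
  phi_extreme p q xi kappa tau eta (k + 2) z
  = (z - RtoC (extreme_coef p q xi kappa tau eta (k + 2)) * z ^ (k + 2))%C.
Proof.
unfold phi_extreme. replace (Nat.eqb (k + 2) 1) with false
  by (symmetry; apply Nat.eqb_neq; lia).
assert (Hw : pqnum p q (k + 2) ^ kappa * (INR (k + 2) - eta)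
    * (1 + (pqnum p q (k + 2) - 1) * tau) * (1 + (INR (k + 2) - 1) * tau) ^ xi
  = (INR (k + 2) - eta) * den_weight tau p q xi kappa (k + 2))
  by (unfold den_weight, upsilon_weight; ring).
rewrite Hw. reflexivity.
Qed.

(** * Correspondence between coefficients and convex weights *)

Theorem theorem5p2 (p q eta tau : R) (kappa xi : nat) (phi : C -> C)
    (hp : 0 < p) (hpq : p < q) (hq : q <= 1)
    (heta0 : 0 <= eta) (heta1 : eta < 1)
    (htau0 : 0 <= tau) (htau1 : tau <= 1) :
  class_P p q xi kappa tau eta phi <->
  exists mu : nat -> R,
    (forall nu : nat, (1 <= nu)%nat -> 0 <= mu nu) /\
    is_series (fun k : nat => mu (k + 1)%nat) 1 /\
    (forall z : C, Omega z ->
       is_series (K := C_AbsRing) (V := C_NormedModule)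
         (fun k : nat => (RtoC (mu (k + 1)%nat)
            * phi_extreme p q xi kappa tau eta (k + 1) z)%C)
         (phi z)).
Proof.
set (e := extreme_coef p q xi kappa tau eta).
assert (Hd : forall n, (2 <= n)%nat ->
  0 < (INR n - eta) * den_weight tau p q xi kappa n).
{ intros n Hn. assert (2 <= INR n) by (apply (le_INR 2); exact Hn).
  apply Rmult_lt_0_compat; [lra | apply den_weight_pos; (lra || lia)]. }
assert (Hepos : forall n, (2 <= n)%nat -> 0 < e n).
{ intros n Hn. apply Rdiv_lt_0_compat; [lra | apply Hd, Hn]. }
(* In units of the extreme coefficients the coefficient inequality says that the sum of [c n / e n]
   is at most 1. *)
assert (Hee : forall n x, (2 <= n)%nat ->
  (INR n - eta) * (den_weight tau p q xi kappa n * x) = (1 - eta) * (x / e n)).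
{ intros n x Hn. unfold e, extreme_coef. assert (H := Hd n Hn). field.
  split; [|split]; try lra; intros H0; rewrite H0 in H; lra. }
split.
- intros [HQ [_ [c [Hpos He]]]].
  apply (class_Q_iff_sum_le p q eta tau kappa xi phi c) in HQ;
    [| assumption .. | lra | lra | assumption | assumption].
  destruct HQ as [Hex Hle].
  set (m := fun k => c (k + 2)%nat / e (k + 2)%nat).
  assert (Hm : ex_series m).
  { apply (ex_series_scal_l (K := R_AbsRing) (V := R_NormedModule) (/ (1 - eta))) in Hex.
    revert Hex. apply ex_series_ext. intros k. rewrite Hee by lia.
    unfold scal; simpl; unfold mult; simpl. unfold m. field.
    split; [|lra]. apply Rgt_not_eq, Hepos; lia. }
  assert (HmS : Series m <= 1).
  { rewrite (Series_ext _ (fun k => (1 - eta) * m k)), Series_scal_l in Hle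
      by (intros k; apply Hee; lia). nra. }
  (* The weight of the identity function takes up the slack, so that the total is 1. *)
  exists (fun n => if Nat.eqb n 1 then 1 - Series m else c n / e n).
  assert (Hk : forall k, Nat.eqb (S k + 1) 1 = false)
    by (intros k; apply Nat.eqb_neq; lia).
  split; [|split].
  + intros n Hn. destruct (Nat.eqb_spec n 1); [lra|].
    apply Rmult_le_pos; [apply Hpos; lia|].
    left. apply Rinv_0_lt_compat, Hepos. lia.
  + apply is_series_decr_1.
    replace (plus 1 _) with (Series m) by (unfold plus, opp; simpl; ring).
    generalize (Series_correct m Hm). apply is_series_ext. intros k.
    rewrite Hk. unfold m. replace (S k + 1)%nat with (k + 2)%nat by lia. reflexivity.
  + intros z Hz. apply is_series_decr_1.
    assert (HzS : is_series (K := C_AbsRing) (V := C_NormedModule)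
      (fun k => RtoC (m k) * z)%C (RtoC (Series m) * z)%C).
    { apply is_series_RtoC_mult, Series_correct, Hm. }
    (* With [S = Series m], removing the first term [(1 - S) z] leaves [S z + (phi z - z)], the sum
       of the linear parts plus the expansion of [phi]. *)
    assert (H := is_series_plus _ _ _ _ HzS (He z Hz)).
    replace (plus (phi z) _) with (plus (RtoC (Series m) * z)%C (phi z - z)%C)
      by (unfold plus, opp, phi_extreme; simpl; rewrite RtoC_minus; ring).
    revert H. apply is_series_ext. intros k. rewrite Hk.
    replace (S k + 1)%nat with (k + 2)%nat by lia.
    rewrite phi_extreme_ge2. fold e.
    transitivity (RtoC (m k) * z - RtoC (m k * e (k + 2)%nat) * z ^ (k + 2))%C.
    * replace (m k * e (k + 2)%nat)%R with (c (k + 2)%nat)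
        by (unfold m; field; apply Rgt_not_eq, Hepos; lia).
      unfold plus; simpl. ring.
    * rewrite RtoC_mult. unfold m. simpl. ring.
- intros [mu [Hmu [Hmu1 Hphi]]].
  set (c := fun n => mu n * e n).
  assert (Hpos : forall n, (2 <= n)%nat -> 0 <= c n).
  { intros n Hn. apply Rmult_le_pos; [apply Hmu; lia | left; apply Hepos, Hn]. }
  assert (He : is_expansion phi (fun n => - RtoC (c n))%C).
  { intros z Hz.
    (* As the weights sum to 1, their linear parts sum to [z]; subtracting these leaves only the
       powers [z^n] with [n >= 2]. *)
    assert (HzS : is_series (K := C_AbsRing) (V := C_NormedModule)
      (fun k => RtoC (mu (k + 1)%nat) * z)%C z).
    { assert (H := is_series_RtoC_mult _ _ z Hmu1). rewrite Cmult_1_l in H. exact H. }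
    assert (H := is_series_minus _ _ _ _ (Hphi z Hz) HzS).
    (* The entry 0 is what remains of the first extreme function after the subtraction; dropping it
       shifts the index from [k + 1] to [k + 2]. *)
    set (f := fun k => match k with
      | O => RtoC 0
      | S k => (- RtoC (c (k + 2)%nat) * z ^ (k + 2))%C end).
    apply (is_series_ext _ f) in H.
    - apply (is_series_incr_1 f).
      assert (Hsum : plus (G := C_NormedModule) (phi z - z)%C (f O)
                     = plus (G := C_NormedModule) (phi z) (opp (G := C_NormedModule) z))
        by (unfold f, plus, opp; simpl; ring).
      rewrite Hsum. exact H.
    - intros [|k].
      + unfold phi_extreme, plus, opp; simpl. ring.
      + replace (S k + 1)%nat with (k + 2)%nat by lia.
        rewrite phi_extreme_ge2. fold e. unfold f, c. rewrite RtoC_mult.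
        unfold plus, opp; simpl. ring. }
  assert (Hm : is_series (fun k => mu (k + 2)%nat) (1 - mu 1%nat)).
  { assert (H : is_series (fun k => mu (S k + 1)%nat) (1 - mu 1%nat)).
    { apply (is_series_incr_1 (fun k => mu (k + 1)%nat)).
      replace (plus _ _) with 1 by (unfold plus; simpl; ring). exact Hmu1. }
    revert H. apply is_series_ext. intros k. f_equal. lia. }
  (* The weighted sum is exactly [(1 - eta) (1 - mu 1)], so the required bound amounts to
     [mu 1 >= 0]. *)
  assert (Hs : is_series (fun k => (INR (k + 2) - eta)
      * (den_weight tau p q xi kappa (k + 2) * c (k + 2)%nat))
      ((1 - eta) * (1 - mu 1%nat))).
  { generalize (is_series_scal (K := R_AbsRing) (V := R_NormedModule) (1 - eta) _ _ Hm).
    apply is_series_ext. intros k. rewrite Hee by lia.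
    unfold scal; simpl; unfold mult; simpl. unfold c. field.
    apply Rgt_not_eq, Hepos; lia. }
  split.
  + apply (class_Q_iff_sum_le p q eta tau kappa xi phi c);
      [assumption .. | lra | lra | assumption | assumption |].
    split; [eexists; exact Hs|]. rewrite (is_series_unique _ _ Hs).
    assert (H1 := Hmu 1%nat ltac:(lia)). nra.
  + split; [| exists c; split; assumption].
    apply (class_A_of_expansion phi c); [|exact He].
    exact (disc_conv_of_expansion phi c Hpos He).
Qed.
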